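(* Let $G$ be a finite simple graph and $r\ge1$ an integer. If $\iota_r(G)>\frac{\omega(G)}{2}$, then $\chi_r(G)-M_r(G)\le\frac{\omega(G)+\Delta(G)+1}{2}$.
   Context: An $r$-bounded coloring of $G$ is a proper coloring in which every color class has at most $r$ vertices. $\chi_r(G)$ is the minimum number of color classes in an $r$-bounded coloring of $G$; an $r$-bounded coloring with $\chi_r(G)$ classes is an optimal $r$-bounded coloring. $M_r(G)$ is the maximum, over all optimal $r$-bounded colorings, of the number of color classes of size exactly $r$. $\iota_r(G)$ (the $r$-bounded stinginess) is the maximum number of singleton color classes in an optimal $r$-bounded coloring of $G$. $\omega(G)$, $\Delta(G)$ are the clique number and maximum degree. *)

(* Defs.v *)
From mathcomp Require Import all_boot all_order all_algebra.

Set Implicit Arguments.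
Unset Strict Implicit.
Unset Printing Implicit Defensive.

(* A finite simple graph is a symmetric irreflexive relation e on a finType T;
   symmetry and irreflexivity are hypotheses of the results. *)

Definition proper_coloring (T : finType) (e : rel T) (C : eqType)
    (c : T -> C) : bool :=
  [forall x, forall y, e x y ==> (c x != c y)].

(* The nonempty fibers of c; unused colors do not count. *)
Definition color_classes (T : finType) (C : eqType) (c : T -> C) :
    {set {set T}} :=
  preim_partition c [set: T].

Definition bounded_coloring (T : finType) (e : rel T) (r : nat) (C : eqType)
    (c : T -> C) : bool :=
  proper_coloring e c && [forall B in color_classes c, #|B| <= r].

(* The extrema below range over colorings with colors taken in T itself; this
   loses nothing, since every coloring has the same classes as one of these. *)
Lemma recolor (T : finType) (e : rel T) (r : nat) (C : eqType) (c : T -> C) :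
  exists f : {ffun T -> T}, color_classes f = color_classes c /\
    bounded_coloring e r f = bounded_coloring e r c.
Proof.
pose g x := odflt x [pick z | c z == c x].
have gK x : c (g x) = c x.
  by rewrite /g; case: pickP => [z /eqP|/(_ x)] //=; rewrite eqxx.
have gE x y : (g x == g y) = (c x == c y).
  apply/eqP/eqP => [gxy|cxy]; first by rewrite -gK gxy gK.
  rewrite /g (eq_pick (Q := fun z => c z == c y)); last by move=> z; rewrite cxy.
  by case: pickP => [z|/(_ y)] //=; rewrite eqxx.
have fE x y : ([ffun z => g z] x == [ffun z => g z] y) = (c x == c y).
  by rewrite !ffunE gE.
have clE : color_classes [ffun z => g z] = color_classes c.
  apply: eq_imset => x; apply/setP => y.
  by rewrite !inE /= fE.
exists [ffun z => g z]; split=> //.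
rewrite /bounded_coloring clE; congr (_ && _).
by apply: eq_forallb => x; apply: eq_forallb => y; rewrite fE.
Qed.

(* For r > 0 the injective coloring is r-bounded, so the minimum exists. *)
Lemma bounded_coloring_id (T : finType) (e : rel T) (r : nat) :
  irreflexive e -> 0 < r -> bounded_coloring e r [ffun x : T => x].
Proof.
move=> e_irr r_gt0; apply/andP; split.
  apply/forallP => x; apply/forallP => y; apply/implyP; rewrite !ffunE.
  by apply: contraTneq => ->; rewrite e_irr.
apply/forall_inP => _ /imsetP[x _ ->]; apply: leq_trans r_gt0.
rewrite -(cards1 x); apply: subset_leq_card; apply/subsetP => y.
by rewrite !inE /= !ffunE eq_sym.
Qed.

Definition bounded_chi (T : finType) (e : rel T) (r : nat) : nat :=
  #|color_classes
      [arg min_(f < [ffun x : T => x] | bounded_coloring e r f)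
         #|color_classes f|]|.

Definition optimal_coloring (T : finType) (e : rel T) (r : nat)
    (f : {ffun T -> T}) : bool :=
  bounded_coloring e r f && (#|color_classes f| == bounded_chi e r).

Definition classes_of_size (T : finType) (k : nat) (f : {ffun T -> T}) : nat :=
  #|[set B in color_classes f | #|B| == k]|.

Definition max_full_classes (T : finType) (e : rel T) (r : nat) : nat :=
  \max_(f : {ffun T -> T} | optimal_coloring e r f) classes_of_size r f.

Definition stinginess (T : finType) (e : rel T) (r : nat) : nat :=
  \max_(f : {ffun T -> T} | optimal_coloring e r f) classes_of_size 1 f.

Definition is_clique (T : finType) (e : rel T) (A : {set T}) : bool :=
  [forall x in A, forall y in A, (x != y) ==> e x y].

Definition clique_number (T : finType) (e : rel T) : nat :=
  \max_(A : {set T} | is_clique e A) #|A|.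

Definition max_degree (T : finType) (e : rel T) : nat :=
  \max_(x : T) #|[set y | e x y]|.

(* Main.v *)
(** Fix an optimal coloring with a maximum number k of singleton classes and let
    t be the number of classes of size strictly between 1 and r; then
    chi_r - M_r <= k + t. A singleton s has a neighbor in each of these t
    classes (otherwise it could join it), and it is adjacent to the other
    singletons. If s has exactly one neighbor a in a class, exchanging s and a
    gives another optimal coloring, in which a is a singleton. If every
    singleton had at least d = omega - k + 1 such tight classes, then, as
    k >= d, a greedy choice would give d singletons with distinct tight
    classes; their d neighbors there, together with the k singletons, would
    form a clique of size omega + 1. So some singleton s has at most omega - k
    tight classes, whence Delta >= deg s >= (k - 1) + 2t - (omega - k). *)

Require Import Defs.
From mathcomp Require Import all_boot all_order all_algebra perm.
From mathcomp Require Import zify lra.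
Import Order.TTheory GRing.Theory Num.Theory.
Local Open Scope ring_scope.

Set Implicit Arguments.
Unset Strict Implicit.
Unset Printing Implicit Defensive.

(** * Color classes indexed by colors, and singleton classes *)

Section Fibers.
Local Open Scope nat_scope.
Variables (T : finType) (f : {ffun T -> T}).

Definition fiber (c : T) : {set T} := [set y | f y == c].

Lemma mem_fiber (x : T) : x \in fiber (f x).
Proof. by rewrite inE. Qed.

Lemma color_classesE : color_classes f = fiber @: (f @: [set: T]).
Proof.
rewrite -imset_comp; apply: eq_imset => x; apply/setP => y.
by rewrite !inE /= eq_sym.
Qed.

Lemma fiber_inj : {in f @: [set: T] &, injective fiber}.
Proof.
move=> _ c /imsetP[x _ ->] _ /setP/(_ x).
by rewrite mem_fiber inE => /esym/eqP.
Qed.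

Lemma card_color_classes : #|color_classes f| = #|f @: [set: T]|.
Proof. by rewrite color_classesE (card_in_imset fiber_inj). Qed.

Lemma classes_of_sizeE (k : nat) :
  classes_of_size k f = #|[set c in f @: [set: T] | #|fiber c| == k]|.
Proof.
rewrite /classes_of_size color_classesE.
set K := [set c in f @: [set: T] | _].
have sK : {subset K <= f @: [set: T]} by move=> c; rewrite inE => /andP[].
rewrite -(card_in_imset (sub_in2 sK fiber_inj)).
congr #|pred_of_set _|; apply/setP => B; rewrite inE.
apply/andP/imsetP => [[/imsetP[c cK ->] sz]|[c]].
  by exists c => //; rewrite inE cK.
by rewrite inE => /andP[cK sz] ->; split=> //; apply: imset_f.
Qed.

Definition lonely (x : T) : bool := fiber (f x) == [set x].

Lemma lonelyP (x : T) : reflect (forall y, f y = f x -> y = x) (lonely x).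
Proof.
apply: (iffP eqP) => [/setP fx y fy|fx].
  by move/(_ y): fx; rewrite !inE fy eqxx => /esym/eqP.
by apply/setP => y; rewrite !inE; apply/eqP/eqP => [/fx|->].
Qed.

Lemma lonelyE (x : T) : lonely x = (#|fiber (f x)| == 1).
Proof.
apply/eqP/cards1P => [->|[z fz]]; first by exists x.
by move: (mem_fiber x); rewrite fz inE => /eqP <-.
Qed.

Lemma card_lonely : classes_of_size 1 f = #|[set x | lonely x]|.
Proof.
rewrite classes_of_sizeE.
have f_inj : {in [set x | lonely x] &, injective f}.
  by move=> x y _; rewrite inE => /lonelyP fy /fy.
rewrite -(card_in_imset f_inj).
congr #|pred_of_set _|; apply/setP => c; rewrite inE.
apply/andP/imsetP => [[/imsetP[x _ ->] sz]|[x + ->]].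
  by exists x => //; rewrite inE lonelyE.
by rewrite inE lonelyE => sz; split=> //; apply: imset_f.
Qed.

Lemma bounded_coloringP (e : rel T) (r : nat) :
  reflect ((forall x y, e x y -> f x <> f y) /\
           (forall x, #|fiber (f x)| <= r))
          (bounded_coloring e r f).
Proof.
apply: (iffP andP) => [[/forallP pf /forall_inP bf]|[pf bf]]; split.
- by move=> x y exy; move/forallP/(_ y)/implyP/(_ exy)/eqP: (pf x).
- by move=> x; apply: bf; rewrite color_classesE !imset_f.
- apply/forallP => x; apply/forallP => y; apply/implyP => exy.
  by apply/eqP; apply: pf.
- apply/forall_inP => B; rewrite color_classesE.
  by move=> /imsetP[_ /imsetP[x _ ->] ->].
Qed.

End Fibers.


(** Induction on [d]: after [d] choices only [d] values are taken, so a further [s] with more than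
    [d] candidates in [J s] still has a free one. *)
Lemma greedy_representatives (T U : finType) (u0 : U) (J : T -> {set U})
    (S : {set T}) (d : nat) :
  (d <= #|S|)%N -> (forall s, s \in S -> (d <= #|J s|)%N) ->
  exists (D : {set T}) (g : T -> U),
    [/\ D \subset S, #|D| = d, {in D, forall s, g s \in J s} &
        {in D &, injective g}].
Proof.
elim: d => [|d IH] dS dJ.
  exists set0, (fun=> u0); split; rewrite ?sub0set ?cards0 // => s.
    by rewrite inE.
  by move=> t; rewrite inE.
have [s /dJ /ltnW //|D [g [sDS cD gJ g_inj]]] := IH (ltnW dS).
have [s sS sD] : exists2 s, s \in S & s \notin D.
  by apply/subsetPn; apply: contraL dS => /subset_leq_card; rewrite cD -leqNgt.
have [c cJ cg] : exists2 c, c \in J s & c \notin g @: D.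
  apply/subsetPn; apply: contraL (dJ s sS) => /subset_leq_card.
  by rewrite (card_in_imset g_inj) cD -leqNgt.
have neqs t : t \in D -> (t == s) = false by apply: contraTF => /eqP->.
have cNg t : t \in D -> c <> g t.
  by move=> tD cE; rewrite cE imset_f in cg.
exists (s |: D), (fun t => if t == s then c else g t); split.
- by rewrite subUset sub1set sS.
- by rewrite cardsU1 sD cD.
- by move=> t /setU1P[->|tD]; rewrite ?eqxx ?neqs //; apply: gJ.
- move=> t u /setU1P[->|tD] /setU1P[->|uD]; rewrite ?eqxx ?neqs //.
  + by move/cNg; case.
  + by move/esym/cNg; case.
  + exact: g_inj.
Qed.

(** * Recoloring a singleton in an optimal coloring *)

Section Optimal.
Local Open Scope nat_scope.
Variables (T : finType) (e : rel T).
Hypotheses (e_sym : symmetric e) (e_irr : irreflexive e).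
Variables (r : nat) (r_gt0 : 0 < r).

Lemma bounded_chi_min (f : {ffun T -> T}) :
  bounded_coloring e r f -> bounded_chi e r <= #|f @: [set: T]|.
Proof.
move=> bf; rewrite /bounded_chi -card_color_classes.
by case: arg_minnP => [|g _]; [apply: bounded_coloring_id|apply].
Qed.

Lemma optimal_coloring_ex : exists f : {ffun T -> T}, optimal_coloring e r f.
Proof.
rewrite /optimal_coloring /bounded_chi.
case: arg_minnP => [|g bg _]; first exact: bounded_coloring_id.
by exists g; rewrite bg eqxx.
Qed.

(* Otherwise [x] could be moved to the class of [y], saving a color. *)
Lemma lonely_neighbor (f : {ffun T -> T}) (x y : T) :
  optimal_coloring e r f -> lonely f x -> x != y -> #|fiber f (f y)| < r ->
  exists2 z, f z = f y & e x z.
Proof.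
move=> /andP[bf /eqP chiE] /lonelyP fx xy szy.
have fyx : f y <> f x by move/fx => yx; rewrite yx eqxx in xy.
have [/exists_inP[z /eqP]|/exists_inPn noz] := boolP [exists z in [pred z | f z == f y], e x z].
  by exists z.
have [pf szf] := bounded_coloringP _ _ _ bf.
pose h := [ffun z => if z == x then f y else f z].
have h_other z : z != x -> h z = f z by rewrite ffunE => /negPf->.
have hx : h x = f y by rewrite ffunE eqxx.
suff bh : bounded_coloring e r h.
  (* [h] uses only colors of [f] and drops [f x], which belonged to [x] alone. *)
  have := bounded_chi_min bh; rewrite -chiE card_color_classes leqNgt.
  case/negP; apply: proper_card; apply/properP; split.
    apply/subsetP => _ /imsetP[z _ ->].
    by rewrite ffunE; case: ifP => _; apply: imset_f.
  exists (f x); first exact: imset_f.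
  apply/imsetP => -[z _]; rewrite ffunE; case: eqP => [_ /esym//|zx /esym/fx//].
apply/bounded_coloringP; split=> [z w|z].
  have [->|zx] := eqVneq z x; have [->|wx] := eqVneq w x.
  - by rewrite e_irr.
  - rewrite hx h_other // => exw /esym/eqP fw.
    by move/negP: (noz w fw); apply.
  - rewrite hx h_other // e_sym => exz /eqP fz.
    by move/negP: (noz z fz); apply.
  - by rewrite !h_other //; apply: pf.
have [hzy|hzy] := eqVneq (h z) (f y).
  apply: leq_trans szy; rewrite hzy -[(#|_|).+1]add1n -(cards1 x).
  apply: leq_trans (leq_card_setU _ _); apply: subset_leq_card.
  apply/subsetP => w; rewrite !inE ffunE.
  by case: (w == x).
have zx : z != x by apply: contraNneq hzy => ->; rewrite hx.
rewrite h_other // in hzy *.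
apply: leq_trans (szf z); apply: subset_leq_card; apply/subsetP => w.
by rewrite !inE ffunE; case: (w == x) => //; rewrite eq_sym (negPf hzy).
Qed.

(** Nonadjacent singletons could be merged, as [1 < r] leaves room for two vertices. *)
Lemma lonely_adj (f : {ffun T -> T}) (x y : T) :
  1 < r -> optimal_coloring e r f -> lonely f x -> lonely f y -> x != y ->
  e x y.
Proof.
move=> r_gt1 of_ fx fy xy.
have /(lonely_neighbor of_ fx xy)[z] : #|fiber f (f y)| < r.
  by rewrite (eqP fy) cards1.
by move/(lonelyP _ _ fy) => ->.
Qed.

(** * Exchanging a singleton with a vertex of another class *)

Definition swap_coloring (f : {ffun T -> T}) (s a : T) : {ffun T -> T} :=
  [ffun x => f (tperm s a x)].

(** A transposition of vertices preserves class sizes and used colors. Properness can fail only at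
    [s] or [a]; but [s] enters a class where its sole neighbor was [a], and [a] ends up alone. *)
Lemma optimal_swap (f : {ffun T -> T}) (s a : T) :
  optimal_coloring e r f -> lonely f s -> e s a ->
  (forall y, e s y -> f y = f a -> y = a) ->
  optimal_coloring e r (swap_coloring f s a).
Proof.
move=> /andP[bf /eqP chiE] /lonelyP fs esa uniq_a.
have [pf szf] := bounded_coloringP _ _ _ bf.
apply/andP; split; last first.
  rewrite -chiE !card_color_classes; apply/eqP; congr #|pred_of_set _|.
  apply/setP => c; apply/imsetP/imsetP => -[x _ ->].
    by rewrite ffunE; exists (tperm s a x).
  by exists (tperm s a x) => //; rewrite ffunE tpermK.
apply/bounded_coloringP; split=> [|z]; last first.
  rewrite -(card_imset _ (@perm_inj _ (tperm s a))) ffunE.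
  apply: leq_trans (szf (tperm s a z)); apply: subset_leq_card.
  by apply/subsetP => _ /imsetP[w + ->]; rewrite !inE !ffunE.
have main x y : e x y -> x = s \/ x = a -> f (tperm s a x) <> f (tperm s a y).
  move=> exy [] xE; rewrite xE ?tpermL ?tpermR in exy *; last first.
    move/esym/fs/(congr1 (tperm s a)); rewrite tpermK tpermL => ya.
    by rewrite ya e_irr in exy.
  case: tpermP => [ys|_ /fs as_|ya _ /esym/(uniq_a _ exy)//].
    by rewrite ys e_irr in exy.
  by rewrite as_ e_irr in esa.
move=> x y exy; rewrite !ffunE.
case: (eqVneq x s) => [xs|xs]; first by apply: main => //; left.
case: (eqVneq x a) => [xa|xa]; first by apply: main => //; right.
rewrite e_sym in exy.
case: (eqVneq y s) => [ys|ys]; first by apply/nesym/main => //; left.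
case: (eqVneq y a) => [ya|ya]; first by apply/nesym/main => //; right.
by rewrite !tpermD 1?eq_sym // e_sym in exy *; apply: pf.
Qed.

Lemma lonely_swap (f : {ffun T -> T}) (s a u : T) :
  lonely (swap_coloring f s a) u = lonely f (tperm s a u).
Proof.
apply/lonelyP/lonelyP => fu y; last by rewrite !ffunE => /fu/perm_inj.
move=> fy; rewrite -[y](tpermK s a); congr (tperm s a _).
by apply: fu; rewrite !ffunE tpermK.
Qed.

(** * Tight classes: the clique they yield and the degree count *)

Definition neighbors (x : T) : {set T} := [set y | e x y].

Definition medium (f : {ffun T -> T}) : {set T} :=
  [set c in f @: [set: T] | 1 < #|fiber f c| < r].

Definition tight (f : {ffun T -> T}) (s : T) : {set T} :=
  [set c in medium f | #|neighbors s :&: fiber f c| == 1].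

(* Two representatives become singletons simultaneously after two swaps, and
   a representative and another singleton after one: hence they are adjacent. *)
Lemma tight_clique (f : {ffun T -> T}) (D : {set T}) (g : T -> T) :
  1 < r -> optimal_coloring e r f ->
  {in D, forall s, lonely f s} -> {in D, forall s, g s \in tight f s} ->
  {in D &, injective g} ->
  #|[set x | lonely f x]| + #|D| <= clique_number e.
Proof.
move=> r_gt1 of_ DS Dg g_inj; set S := [set x | lonely f x].
(* The unique neighbor of [s] in its tight class; the default [s] is never reached for [s] in
   [D]. *)
pose a s := odflt s [pick y in neighbors s :&: fiber f (g s)].
have aP s : s \in D -> [/\ e s (a s), f (a s) = g s, a s \notin S &
    forall y, e s y -> f y = g s -> y = a s].
  move=> /Dg; rewrite !inE => /andP[/andP[_ /andP[gt1 _]]] /cards1P[y yE].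
  rewrite /a yE; case: pickP => [z|/(_ y)]; last by rewrite inE eqxx.
  rewrite inE => /eqP-> /=.
  have : y \in [set y] by rewrite inE.
  rewrite -yE !inE => /andP[esy /eqP fy]; split=> //.
    by rewrite lonelyE fy; case: (#|_|) gt1 => [|[]].
  by move=> w esw /eqP fw; apply/eqP; rewrite -in_set1 -yE !inE esw.
have a_inj : {in D &, injective a}.
  move=> s t sD tD st; apply: g_inj => //.
  by have [_ <- _ _] := aP _ sD; have [_ <- _ _] := aP _ tD; rewrite st.
have Sa x s : s \in D -> x \in S -> x != a s.
  by move=> /aP[_ _ + _] xS; apply: contraNneq => <-.
have swapP s : s \in D -> optimal_coloring e r (swap_coloring f s (a s)).
  move=> sD; have [esa fa _ uq] := aP _ sD.
  by apply: optimal_swap => //; [apply: DS|rewrite fa].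
have adj_Sa x s : x \in S -> s \in D -> e x (a s).
  move=> xS sD; have [->|xs] := eqVneq x s; first by case: (aP _ sD).
  have xa := Sa _ _ sD xS.
  apply: lonely_adj (swapP _ sD) _ _ (xa) => //; rewrite lonely_swap.
    by rewrite tpermD 1?eq_sym //; move: xS; rewrite inE.
  by rewrite tpermR DS.
have adj_aa s t : s \in D -> t \in D -> s != t -> e (a s) (a t).
  move=> sD tD st.
  have [sS tS] : s \in S /\ t \in S by rewrite !inE !DS.
  have [_ fas asS _] := aP _ sD; have [eta fat atS uqt] := aP _ tD.
  have aa : a s != a t by apply: contraNneq st => /a_inj->.
  have gst : g s <> g t by move/(g_inj _ _ sD tD) => E; rewrite E eqxx in st.
  have atE : tperm s (a s) (a t) = a t by rewrite tpermD // ?Sa // eq_sym.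
  have tE : tperm s (a s) t = t by rewrite tpermD // eq_sym Sa.
  set h := swap_coloring f s (a s).
  (* The first exchange leaves the class of color [g t] intact: [s] gets color [g s] and [a s] the
     color of the singleton [s], both different from [g t]. So [a t] is still the only neighbor of
     [t] there. *)
  have oh' : optimal_coloring e r (swap_coloring h t (a t)).
    apply: optimal_swap; rewrite ?lonely_swap ?tE ?DS ?swapP // => y ety.
    rewrite !ffunE atE fat; case: tpermP => [_|yE|_ _]; last exact: uqt.
      by rewrite fas.
    move/lonelyP: (DS _ sD) => ls.
    by move=> fs; move: atS; rewrite (ls (a t)) ?fat // sS.
  apply: lonely_adj oh' _ _ (aa); rewrite // !lonely_swap.
    rewrite (_ : tperm t (a t) (a s) = a s); first by rewrite tpermR DS.
    by apply: tpermD; [apply: Sa|rewrite eq_sym].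
  by rewrite tpermR tE DS.
have cardQ : #|S :|: a @: D| = #|S| + #|D|.
  rewrite cardsU (card_in_imset a_inj) (_ : _ :&: _ = set0) ?cards0 ?subn0 //.
  apply/setP => x; rewrite in_setI in_set0; apply/andP => -[xS /imsetP[s sD xE]].
  by have := Sa _ _ sD xS; rewrite xE eqxx.
rewrite -cardQ; apply: (leq_bigmax_cond (F := fun A : {set T} => #|A|)).
apply/forall_inP => x xQ; apply/forall_inP => y yQ; apply/implyP.
case/setUP: xQ => [xS|/imsetP[s sD ->]]; case/setUP: yQ => [yS|/imsetP[t tD ->]].
- by rewrite !inE in xS yS; apply: lonely_adj of_ _ _.
- by move=> _; apply: adj_Sa.
- by move=> _; rewrite e_sym; apply: adj_Sa.
- by move=> ne; apply: adj_aa => //; apply: contraNneq ne => ->.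
Qed.

(** Count the neighbors of [s] color by color: every other singleton gives one, a tight class one,
    any other medium class at least two. The final 1 accounts for [s] itself. *)
Lemma lonely_degree (f : {ffun T -> T}) (s : T) :
  1 < r -> optimal_coloring e r f -> lonely f s ->
  #|[set x | lonely f x]| + (#|medium f|).*2
    <= #|neighbors s| + #|tight f s| + 1.
Proof.
move=> r_gt1 of_ fs; set S := [set x | lonely f x].
have sS : s \in S by rewrite inE.
have f_inj : {in S :\ s &, injective f}.
  by move=> x y _; rewrite !inE => /andP[_ /lonelyP fy] /fy.
suff : #|f @: (S :\ s)| + #|medium f| * 2 <= #|neighbors s| + #|tight f s|.
  by rewrite (card_in_imset f_inj) (cardsD1 s S) sS; lia.
have degE : #|neighbors s| = \sum_(c : T) #|neighbors s :&: fiber f c|.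
  rewrite -sum1_card (partition_big f predT) //=; apply: eq_bigr => c _.
  by rewrite -sum1_card; apply: eq_bigl => y; rewrite !inE.
have cardE (A : {set T}) : #|A| = \sum_(c : T) (c \in A).
  by rewrite -sum1_card big_mkcond; apply: eq_bigr => c _; case: (c \in A).
rewrite degE !cardE big_distrl -!big_split /=; apply: leq_sum => c _.
have [cM|cM] := boolP (c \in medium f).
  have cS : c \notin f @: (S :\ s).
    apply/imsetP => -[x]; rewrite !inE => /andP[_]; rewrite lonelyE => /eqP sz cE.
    by move: cM; rewrite inE cE sz ltnn andbF.
  (* For [n] neighbors in the class, [0 < n] suffices for [2 <= n + (n == 1)]. *)
  have n_gt0 : 0 < #|neighbors s :&: fiber f c|.
    move: cM; rewrite inE => /andP[/imsetP[y _ cE] /andP[gt1 ltr]].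
    have sy : s != y.
      apply: contraTneq gt1 => sy; rewrite cE -sy.
      by move: fs; rewrite lonelyE => /eqP->.
    rewrite cE in ltr *.
    have [z fz esz] := lonely_neighbor of_ fs sy ltr.
    by apply/card_gt0P; exists z; rewrite !inE esz fz eqxx.
  rewrite (negPf cS) /tight inE cM /=.
  by case: (#|_|) n_gt0 => [|[|n]].
have [/imsetP[x]|] := boolP (c \in f @: (S :\ s)); last by [].
rewrite !inE => /andP[xs fx] cE /=.
suff : 0 < #|neighbors s :&: fiber f c| by lia.
apply/card_gt0P; exists x; rewrite !inE cE eqxx andbT.
by apply: lonely_adj of_ _ _ _ => //; rewrite eq_sym.
Qed.

(** Class sizes lie between 1 and [r]. For [r = 1] full and singleton classes coincide, hence only
    an inequality. *)
Lemma card_colors_split (f : {ffun T -> T}) :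
  optimal_coloring e r f ->
  bounded_chi e r
    <= classes_of_size r f + classes_of_size 1 f + #|medium f|.
Proof.
move=> /andP[bf /eqP <-]; have [_ szf] := bounded_coloringP _ _ _ bf.
rewrite card_color_classes !classes_of_sizeE.
apply: leq_trans (leq_add (leq_card_setU _ _) (leqnn _)).
apply: leq_trans (leq_card_setU _ _); apply: subset_leq_card.
apply/subsetP => c cK; rewrite !inE cK /=.
case/imsetP: cK => x _ ->; have := szf x.
have : 0 < #|fiber f (f x)| by apply/card_gt0P; exists x; apply: mem_fiber.
lia.
Qed.

End Optimal.

(** * The bound on the number of classes that are not full *)

Theorem theorem6p7 (T : finType) (e : rel T)
    (e_sym : symmetric e) (e_irr : irreflexive e)
    (r : nat) (r_ge1 : (1 <= r)%N)
    (h_iota : (clique_number e)%:R / 2 < (stinginess e r)%:R :> rat) :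
  (bounded_chi e r)%:R - (max_full_classes e r)%:R
    <= ((clique_number e)%:R + (max_degree e)%:R + 1) / 2 :> rat.
Proof.
suff key : (2 * bounded_chi e r
    <= clique_number e + max_degree e + 1 + 2 * max_full_classes e r)%N.
  by move: key; rewrite -(ler_nat rat) !(natrM, natrD); lra.
have {}h_iota : (clique_number e < 2 * stinginess e r)%N.
  by rewrite -(ltr_nat rat) natrM; lra.
have [g og] := optimal_coloring_ex e_irr r_ge1.
have [f of_ fE] : exists2 f, optimal_coloring e r f &
    stinginess e r = classes_of_size 1 f.
  have [|f of_ fE] := @eq_bigmax_cond _ [pred h | optimal_coloring e r h]
    (fun h => classes_of_size 1 h); first by apply/card_gt0P; exists g.
  by exists f.
have fullE : (classes_of_size r f <= max_full_classes e r)%N.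
  exact: (leq_bigmax_cond (F := fun h => classes_of_size r h)).
have chiE := card_colors_split r_ge1 of_.
rewrite fE card_lonely in h_iota; rewrite card_lonely in chiE.
set S := [set x | lonely f x] in h_iota chiE.
(* For [r = 1] all classes are full singletons, so the left-hand side is at most 0. *)
have [r_gt1|r_le1] := ltnP 1 r; last first.
  have r1 : r = 1%N by lia.
  have ST : S = [set: T].
    case/andP: of_ => /bounded_coloringP[_ szf] _.
    apply/setP => x; rewrite !inE lonelyE eqn_leq -{1}r1 szf.
    by apply/card_gt0P; exists x; apply: mem_fiber.
  suff : (bounded_chi e r <= max_full_classes e r)%N by lia.
  apply: leq_trans fullE; rewrite r1 card_lonely -/S ST -r1.
  case/andP: of_ => _ /eqP <-; rewrite card_color_classes.
  exact: leq_imset_card.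
(* Chosen so that [#|S| + d] exceeds the clique number, while [h_iota] still gives [d <= #|S|] for
   the greedy choice. *)
pose d := (clique_number e - #|S|).+1.
have [s sS tight_s] : exists2 s, s \in S & (#|tight e r f s| < d)%N.
  apply/exists_inP; apply: contraT => /exists_inPn noS.
  case: (posnP #|S|) => [S0|/card_gt0P[s0 _]]; first by rewrite S0 in h_iota.
  have [||D [h [/subsetP sDS cD hJ h_inj]]] :=
      @greedy_representatives _ _ s0 (tight e r f) S d.
  - by rewrite /d; lia.
  - by move=> s /noS; rewrite -leqNgt.
  have DS : {in D, forall s, lonely f s} by move=> s /sDS; rewrite inE.
  have := tight_clique e_sym e_irr r_ge1 r_gt1 of_ DS hJ h_inj.
  by rewrite cD /d -/S; lia.
(* The case of empty [D]: singletons form a clique, so the subtraction in [d] is not truncated. *)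
have S_clique : (#|S| <= clique_number e)%N.
  have D0 : {in set0 : {set T}, forall s, lonely f s} by move=> x; rewrite inE.
  have J0 : {in set0 : {set T}, forall s, s \in tight e r f s}.
    by move=> x; rewrite inE.
  have := tight_clique e_sym e_irr r_ge1 r_gt1 of_ D0 J0 (in2W (@inj_id T)).
  by rewrite cards0 addn0.
have lonely_s : lonely f s by rewrite inE in sS.
have := lonely_degree e_sym e_irr r_ge1 r_gt1 of_ lonely_s.
have : (#|neighbors e s| <= max_degree e)%N.
  exact: (leq_bigmax (F := fun x => #|[set y | e x y]|)).
(* With m medium classes, [lonely_degree] now reads |S| + 2m <= Delta + (omega - |S|) + 1, that is,
   2(|S| + m) <= omega + Delta + 1; [chiE] concludes. *)
rewrite -/S /d in tight_s *; lia.
Qed.
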